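(* Let $n$ be a friend of $10$, and let $q_4$ be the fourth smallest prime divisor of $n$ (the prime divisors of $n$ being listed without multiplicity in increasing order). Then $$13\leq q_4 < \left\lceil\frac{390\,\omega(n)}{47}\right\rceil\left\{\log\left(\left\lceil\frac{390\,\omega(n)}{47}\right\rceil\right)+2\log\log\left(\left\lceil\frac{390\,\omega(n)}{47}\right\rceil\right)\right\}.$$
   Context: For a positive integer $n$, let $\sigma(n)$ be the sum of the positive divisors of $n$ and let $I(n)=\sigma(n)/n$ be its abundancy index. A friend of $10$ is a positive integer $n\neq 10$ with $I(n)=I(10)=9/5$. $\omega(n)$ denotes the number of distinct prime divisors of $n$, $\lceil\cdot\rceil$ is the ceiling function, and $\log$ is the natural logarithm. The braces in the displayed bound are ordinary grouping brackets (not the fractional part). *)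

(* Defs.v *)
From mathcomp Require Import all_boot all_order all_algebra.

Set Implicit Arguments.
Unset Strict Implicit.
Unset Printing Implicit Defensive.

Import Order.TTheory GRing.Theory Num.Theory.
Local Open Scope ring_scope.

Definition divisor_sum (n : nat) : nat := (\sum_(d <- divisors n) d)%N.

Definition abundancy (n : nat) : rat := (divisor_sum n)%:R / n%:R.

Definition friend_of (m n : nat) : Prop :=
  [/\ (0 < n)%N, n <> m & abundancy n = abundancy m].

Definition omega (n : nat) : nat := size (primes n).

(* [primes n] is increasing and duplicate-free. The rank [k] counts from 1;
   the value is 0 when [k] exceeds [omega n]. *)
Definition kth_prime_divisor (k n : nat) : nat := nth 0%N (primes n) k.-1.

(* Main.v *)
(* With [I(n) = sigma(n) / n <= prod p / (p - 1)] over the primes dividing [n],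
   and all of them at least 5, the first three contribute at most
   [5/4 * 7/6 * 11/10 = 77/48]; the remaining [k = omega(n) - 3], being distinct
   integers [>= q4], contribute at most [(q4 - 1 + k) / (q4 - 1)] by telescoping.
   Since [I(n) = 9/5] this gives [47 (q4 - 1) <= 385 k], so already
   [q4 < 390 omega(n) / 47 <= c], and the factor [ln c + 2 ln (ln c)] is at
   least 1 because [c >= 4 > e]. *)
Require Import Defs.
From HB Require Import structures.
From mathcomp Require Import all_boot all_order all_algebra.
From mathcomp Require Import all_classical all_reals all_analysis.
From mathcomp Require Import zify lra.

Set Implicit Arguments.
Unset Strict Implicit.
Unset Printing Implicit Defensive.

Import Order.TTheory GRing.Theory Num.Theory.
Local Open Scope ring_scope.

(** * The divisor sum: multiplicativity, growth along divisibility, and the Euler product bound *)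

Section DivisorSum.
Local Open Scope nat_scope.

(** Each divisor [d] of [m * n] is a product [a * b] with [a %| m] and [b %| n] in exactly one way:
    [a] is the gcd of [d] and [m]. *)
Lemma divisor_sumM m n : 0 < m -> 0 < n -> coprime m n ->
  divisor_sum (m * n) = divisor_sum m * divisor_sum n.
Proof.
move=> m0 n0 cmn; rewrite /divisor_sum big_distrlr /=.
rewrite -(big_allpairs_dep (h := fun a b => a * b) (F := id)) /=; apply: perm_big.
apply: uniq_perm; first exact: divisors_uniq.
  apply: allpairs_uniq; try exact: divisors_uniq.
  move=> x y /allpairsP[[a b] /= [am bn ->]] /allpairsP[[c d] /= [cm dn ->]] /= e.
  rewrite -!dvdn_divisors // in am bn cm dn.
  have ca u v : u %| m -> v %| n -> gcdn (u * v) m = u.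
    move=> um vn; rewrite gcdnC Gauss_gcdl ?(coprime_dvdr vn) //.
    exact/gcdn_idPr.
  have eac : a = c by rewrite -(ca a b) // e ca.
  have a0 : 0 < a by rewrite (dvdn_gt0 m0 am).
  by move: e; rewrite -eac => /eqP; rewrite eqn_pmul2l // => /eqP ->.
move=> d; rewrite -dvdn_divisors ?muln_gt0 ?m0 //.
apply/idP/allpairsP => [dmn|[[a b] /= [am bn ->]]].
  exists (gcdn d m, gcdn d n); rewrite /= -!dvdn_divisors // !dvdn_gcdr.
  split=> //; apply/eqP; rewrite eqn_dvd; apply/andP; split.
    rewrite muln_gcdl !muln_gcdr !dvdn_gcd dmn.
    by rewrite (dvdn_mull d) ?(dvdn_mulr n) ?(dvdn_mull m).
  rewrite Gauss_dvd ?dvdn_gcdl //.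
  by rewrite (coprime_dvdl (dvdn_gcdr d m)) ?(coprime_dvdr (dvdn_gcdr d n)).
by rewrite -!dvdn_divisors // in am bn; rewrite dvdn_mul.
Qed.

Lemma divisor_sum_pfactor p a : prime p ->
  divisor_sum (p ^ a) = \sum_(i < a.+1) p ^ i.
Proof.
move=> pp; rewrite /divisor_sum -(big_mkord xpredT) /index_iota subn0.
rewrite -(big_map (expn p) xpredT id); apply: perm_big.
apply: uniq_perm; first exact: divisors_uniq.
  rewrite map_inj_uniq ?iota_uniq //.
  exact: (expnI (prime_gt1 pp)).
move=> d; rewrite -dvdn_divisors ?expn_gt0 ?prime_gt0 //.
apply/dvdn_pfactor/mapP => // -[i].
  by exists i => //; rewrite mem_iota.
by rewrite mem_iota => ia ->; exists i.
Qed.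

(** The divisors of [d] scaled by [k] divide [d * k], and the divisor 1 is not among them. *)
Lemma divisor_sum_lt d k : 0 < d -> 1 < k ->
  divisor_sum d * k < divisor_sum (d * k).
Proof.
move=> d0 k1; have k0 : 0 < k by exact: ltnW.
have dk0 : 0 < d * k by rewrite muln_gt0 d0.
set s := 1 :: [seq e * k | e <- divisors d].
have us : uniq s.
  rewrite /= map_inj_uniq ?divisors_uniq ?andbT; last first.
    by move=> x y /eqP; rewrite eqn_pmul2r // => /eqP.
  apply/mapP => -[e _ /esym/eqP]; rewrite muln_eq1 => /andP[_ /eqP ek].
  by rewrite ek in k1.
have sub : {subset s <= divisors (d * k)}.
  move=> x; rewrite inE => /orP[/eqP->|/mapP[e ed ->]].
    by rewrite -dvdn_divisors.
  by rewrite -dvdn_divisors // in ed; rewrite -dvdn_divisors // dvdn_pmul2r.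
have : \sum_(e <- s) e <= divisor_sum (d * k).
  apply: (@uniq_sub_le_big _ _ leq leqnn (fun a b => leq_addr b a)) => //.
  exact: divisors_uniq.
by rewrite big_cons big_map big_distrl.
Qed.

Lemma divisor_sum_dvd d n : 0 < n -> d %| n ->
  divisor_sum d * n <= divisor_sum n * d.
Proof.
move=> n0 /dvdnP[k e]; move: n0; rewrite {n}e muln_gt0 => /andP[k0 d0].
case: (ltngtP k 1) => [|k1|->]; [lia| |by rewrite mul1n].
by have := divisor_sum_lt d0 k1; rewrite (mulnC k); nia.
Qed.

(** Peels off prime powers, each with sigma(p^a) (p - 1) = p^(a+1) - 1. As [s] may exceed
    [primes n], the induction runs on [s]; a head not dividing [n] has exponent 0. *)
Lemma divisor_sum_le_prod (s : seq nat) n : 0 < n -> all prime s ->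
  {subset primes n <= s} ->
  divisor_sum n * \prod_(p <- s) p.-1 <= n * \prod_(p <- s) p.
Proof.
elim: s n => [|p s IH] n n0 /= => [_ sub|/andP[pp ps] sub].
  have -> : n = 1.
    have [/pdivP[p pp pn]|] := ltnP 1 n; last by lia.
    by have := sub p; rewrite mem_primes pp n0 pn => /(_ isT).
  by rewrite !big_nil (@divisor_sum_pfactor 2 0) // big_ord1.
have [m cpm e] := pfactor_coprime pp n0; set a := logn p n in e.
have pa0 : 0 < p ^ a by rewrite expn_gt0 prime_gt0.
have m0 : 0 < m by move: n0; rewrite e muln_gt0 => /andP[].
have subm : {subset primes m <= s}.
  move=> q; rewrite mem_primes => /and3P[qp _ qm].
  have : q \in p :: s by apply: sub; rewrite mem_primes qp n0 e dvdn_mulr.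
  rewrite inE => /orP[/eqP eq|//]; move: cpm.
  by rewrite prime_coprime // -eq qm.
have := IH m m0 ps subm.
have : divisor_sum (p ^ a) * p.-1 <= p ^ a * p.
  rewrite divisor_sum_pfactor // mulnC -predn_exp expnS mulnC; exact: leq_pred.
rewrite {1 2}e divisor_sumM //; last by rewrite coprime_sym coprimeXl.
rewrite !big_cons => h1 h2.
by have := leq_mul h1 h2; rewrite mulnACA (mulnC (_ (p ^ a))) => /leq_trans;
  apply; nia.
Qed.
End DivisorSum.

(* The worst case is [s = y.+1, y.+2, ...], where the product telescopes. *)
Lemma prod_le_telescope (s : seq nat) y : path ltn y s ->
  (y * \prod_(q <- s) q <= (y + size s) * \prod_(q <- s) q.-1)%N.
Proof.
elim: s y => [|q s IH] y /=; first by rewrite !big_nil; lia.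
case/andP => yq /IH; rewrite !big_cons.
move: (\prod_(i <- s) i)%N (\prod_(i <- s) i.-1)%N (size s) => P Q k h.
have : (y * (q * P) <= y * ((q + k) * Q))%N by rewrite leq_mul2l h orbT.
(* Up to the factor [Q], the right side minus the left is (k + 1)(q - 1 - y), nonnegative since y <
   q. *)
by move/leq_trans; apply; rewrite !mulnA leq_mul2r; apply/orP; right; nia.
Qed.

Lemma friend_of_10_sum n : friend_of 10 n ->
  (5 * divisor_sum n = 9 * n)%N.
Proof.
case=> n0 _; rewrite /abundancy.
have -> : divisor_sum 10 = 18%N by rewrite /divisor_sum unlock.
have n0' : n%:R != 0 :> rat by rewrite pnatr_eq0 -lt0n.
move/eqP; rewrite eqr_div // -!natrM eqr_nat => /eqP; lia.
Qed.

(** * Arithmetic of a friend of 10: its small primes and the bound on the fourth *)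

Section FriendOf10.
Local Open Scope nat_scope.
Variable n : nat.
Hypothesis hn : friend_of 10 n.

Let n_gt0 : 0 < n. Proof. by case: hn. Qed.
Let n_sum : 5 * divisor_sum n = 9 * n. Proof. exact: friend_of_10_sum. Qed.

Lemma friend_of_10_dvd5 : 5 %| n.
Proof. by rewrite -(@Gauss_dvdr 5 9) // -n_sum dvdn_mulr. Qed.

(** An even [n] would be a proper multiple of 10, hence of abundancy strictly above 9/5. *)
Lemma friend_of_10_odd : odd n.
Proof.
apply/negPn/negP; rewrite -dvdn2 => n2.
have /dvdnP[k e] : 10 %| n by rewrite (@Gauss_dvd 2 5) // n2 friend_of_10_dvd5.
have k1 : 1 < k by case: hn => _ nn _; move: n_gt0; lia.
have := @divisor_sum_lt 10 k isT k1; rewrite mulnC in e.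
have -> : divisor_sum 10 = 18 by rewrite /divisor_sum unlock.
by rewrite -e; move: n_sum; lia.
Qed.

Lemma friend_of_10_dvd_sum d : d %| n -> 5 * divisor_sum d <= 9 * d.
Proof.
by move/(divisor_sum_dvd n_gt0) => h; move: n_sum n_gt0; nia.
Qed.

(** As [n] is odd, so is sigma(n), hence also its factor sigma(p^a), a sum of a + 1 odd terms; thus
    [a] is even. *)
Lemma friend_of_10_pfactor p : prime p -> odd p ->
  exists a m, [/\ n = m * p ^ a, coprime p m, ~~ odd a &
                  divisor_sum (p ^ a) %| divisor_sum n].
Proof.
move=> pp op; have [m cpm e] := pfactor_coprime pp n_gt0.
set a := logn p n in e *; exists a, m.
have [m0 pa0] : 0 < m /\ 0 < p ^ a by apply/andP; rewrite -muln_gt0 -e.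
have dv : divisor_sum (p ^ a) %| divisor_sum n.
  have : coprime m (p ^ a) by rewrite coprime_sym coprimeXl.
  by move/(divisor_sumM m0 pa0); rewrite -e => ->; rewrite dvdn_mull.
split=> //; have : odd (divisor_sum n).
  by have := congr1 odd n_sum; rewrite !oddM friend_of_10_odd.
move/(fun h => dvdn_odd dv h); rewrite divisor_sum_pfactor //.
suff -> : odd (\sum_(i < a.+1) p ^ i) = odd a.+1 by [].
elim: (a.+1) => [|b IH]; first by rewrite big_ord0.
by rewrite big_ord_recr /= oddD IH oddX op orbT addbT.
Qed.

Lemma friend_of_10_dvd_sqr p : prime p -> odd p -> p %| n -> p ^ 2 %| n.
Proof.
move=> pp op pn; have [[|[|a]] [m [e cpm ev _]]] // := friend_of_10_pfactor pp op.
  by move: pn; rewrite e muln1 => pm; rewrite prime_coprime // pm in cpm.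
by rewrite e dvdn_mull // dvdn_exp2l.
Qed.

(* If 3 divided [n], either [3 ^ 4 * 5 ^ 2], or [3 ^ 2 * 5 ^ 2 * 13] since
   sigma(9) = 13, would divide [n]; both have abundancy above 9/5. *)
Lemma friend_of_10_ndvd3 : ~~ (3 %| n).
Proof.
apply/negP => n3.
have n25 : 5 ^ 2 %| n by apply: friend_of_10_dvd_sqr; rewrite ?friend_of_10_dvd5.
have n9 : 3 ^ 2 %| n by apply: friend_of_10_dvd_sqr.
have [a [m [e c3m ev dv]]] := friend_of_10_pfactor (isT : prime 3) isT.
case: (leqP 4 a) => a4.
  have n81 : 3 ^ 4 %| n by rewrite e dvdn_mull // dvdn_exp2l.
  have : 3 ^ 4 * 5 ^ 2 %| n by rewrite Gauss_dvd // n81.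
  move/friend_of_10_dvd_sum; rewrite divisor_sumM // !divisor_sum_pfactor //.
  by rewrite !big_ord_recr !big_ord0.
have a2 : a = 2.
  move: a a4 ev e {dv} => [|[|[|[|a]]]] // _ _.
  by rewrite muln1 => e; rewrite prime_coprime // -e n3 in c3m.
have n13 : 13 ^ 1 %| n.
  move: dv; rewrite a2 divisor_sum_pfactor // !big_ord_recr big_ord0 /= => dv.
  by rewrite -(@Gauss_dvdr 13 9) // -n_sum dvdn_mull.
have : 3 ^ 2 * 5 ^ 2 * 13 ^ 1 %| n.
  by rewrite (@Gauss_dvd (3 ^ 2 * 5 ^ 2)) // (@Gauss_dvd (3 ^ 2)) // n9 n25.
move/friend_of_10_dvd_sum; rewrite (@divisor_sumM (3 ^ 2 * 5 ^ 2)) //.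
rewrite (@divisor_sumM (3 ^ 2)) // !divisor_sum_pfactor //.
by rewrite !big_ord_recr !big_ord0.
Qed.

Lemma friend_of_10_primes_ge5 p : p \in primes n -> 5 <= p.
Proof.
rewrite mem_primes => /and3P[pp _ pn].
move: p pp pn => [|[|[|[|[|p]]]]] // _; first by rewrite dvdn2 friend_of_10_odd.
by rewrite (negPf friend_of_10_ndvd3).
Qed.

Lemma friend_of_10_prod_le :
  9 * \prod_(p <- primes n) p.-1 <= 5 * \prod_(p <- primes n) p.
Proof.
have pr : all prime (primes n) by apply/allP => p; rewrite mem_primes => /andP[].
have := divisor_sum_le_prod n_gt0 pr (fun p h => h).
by rewrite -(leq_pmul2l n_gt0); move: n_sum; nia.
Qed.

(** The lower bound 13 also excludes the default value 0, so [n] has at least four prime divisors.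
    The term 1155 = 3 * 385 accounts for the three smallest. *)
Lemma friend_of_10_q4 :
  13 <= kth_prime_divisor 4 n /\
  47 * (kth_prime_divisor 4 n).-1 + 1155 <= 385 * omega n.
Proof.
have pr : all prime (primes n) by apply/allP => p; rewrite mem_primes => /andP[].
have := friend_of_10_prod_le; rewrite /kth_prime_divisor /omega.
have := friend_of_10_primes_ge5; move: (sorted_primes n) pr.
(* With smallest primes at least 5, 7, 11, the products of p / (p - 1) over none, one, two or three
   primes are at most 1, 5/4, 35/24, 77/48. All are below 9/5, which closes each case where the list
   ends too early. *)
case: (primes n) => [|a s]; first by rewrite !big_nil.
move=> /= + /andP[_ ps] /(_ a (mem_head _ _)) a5; rewrite !big_cons.
have la : 4 * a <= 5 * a.-1 by lia.
case: s ps => [_ _|b s /andP[pb ps] /= /andP[ab]]; first by rewrite !big_nil; lia.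
have b7 : 7 <= b by move: b pb ab {ps} => [|[|[|[|[|[|[|b]]]]]]] //; lia.
have lb : 6 * b <= 7 * b.-1 by lia.
rewrite !big_cons.
have lab := leq_mul la lb.
case: s ps => [_ _|c s /andP[pc ps] /= /andP[bc]].
  by rewrite !big_nil; move: lab; nia.
have c11 : 11 <= c.
  by move: c pc bc {ps} => [|[|[|[|[|[|[|[|[|[|[|c]]]]]]]]]]] //; lia.
have lc : 10 * c <= 11 * c.-1 by lia.
have labc := leq_mul lab lc.
have A0 : 0 < a.-1 * b.-1 * c.-1.
  by rewrite !muln_gt0; apply/andP; split; [apply/andP; split|]; lia.
rewrite !big_cons.
case: s ps => [_ _|d s /andP[pd _] /= /andP[cd ds]].
  by rewrite !big_nil; lia.
have d13 : 13 <= d by move: (d == 12) (@eqP _ d 12) pd => [] [-> //|] *; lia.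
(* [H], introduced by [split], is the product inequality of [friend_of_10_prod_le]. The telescoping
   bound is then applied to [r] from d - 1. *)
split=> //; set r := d :: s in H *.
have pr : path ltn d.-1 r by rewrite /= ds andbT prednK // (leq_trans _ d13).
have P_gt0 : 0 < \prod_(q <- r) q.
  rewrite big_seq; apply: prodn_cond_gt0 => q.
  by move/(allP (order_path_min ltn_trans pr)); apply: leq_ltn_trans.
suff : 47 * d.-1 <= 385 * size r by rewrite /=; lia.
have := prod_le_telescope pr; move: H P_gt0.
move: (\prod_(q <- r) q) (\prod_(q <- r) q.-1) (size r) d.-1 => P Q k y H P0 T.
set C := a * b * c; set A := a.-1 * b.-1 * c.-1 in A0 *.
have {}H : 9 * A * Q <= 5 * C * P by rewrite /A /C; lia.
have {}labc : 240 * C <= 385 * A by rewrite /A /C; lia.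
have AP0 : 0 < A * P by rewrite muln_gt0 A0.
have h1 := leq_mul (leqnn (9 * A)) T.
have h2 := leq_mul (leqnn (y + k)) H.
have h3 := leq_mul labc (leqnn (P * (y + k))).
(* Chaining [h1], [h2], [h3] and cancelling [A * P] yields 2160 = 9 * 240 and 1925 = 5 * 385; then
   235 = 5 * 47. *)
suff : 235 * y <= 1925 * k by lia.
suff : 2160 * y <= 1925 * (y + k) by lia.
by rewrite -(leq_pmul2l AP0); lia.
Qed.
End FriendOf10.

(** * Passage to the real bound with logarithms *)

Theorem theorem1p3 (R : realType) (n : nat) (hn : friend_of 10 n) :
  let q4 := kth_prime_divisor 4 n in
  let c : R := (Num.ceil (390 * (omega n)%:R / 47 : R))%:~R in
  (13 <= q4)%N /\ q4%:R < c * (ln c + 2 * ln (ln c)).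
Proof.
move=> q4 c; have [q4_ge13 q4_le] := friend_of_10_q4 hn.
rewrite -/q4 in q4_ge13 q4_le; split=> //.
have c_ge : 390 * (omega n)%:R / 47 <= c by exact: ceil_ge.
(* From q4 >= 13: 47 * 12 + 1155 = 1719 > 3 * 385. *)
have w_ge : (4 <= omega n)%N by lia.
have w4 : 4 <= (omega n)%:R :> R by rewrite ler_nat.
have q4_lt : q4%:R < c.
  have : (47 * q4)%:R < (390 * omega n)%:R :> R by rewrite ltr_nat; lia.
  rewrite !natrM; lra.
have c_ge4 : 4 <= c by lra.
have e_le4 : expR 1 <= 4 :> R.
  (* From exp(-1/2) >= 1 - 1/2 comes exp(1/2) <= 2; squaring gives e <= 4. *)
  have := expR_ge1Dx (- (1 / 2) : R); rewrite expRN => h.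
  have e0 := expR_gt0 (1 / 2 : R).
  have e2 : expR (1 / 2) <= 2 :> R.
    by rewrite -(lef_pV2 (_ : _ \is Num.pos)) ?posrE //; lra.
  have -> : 1 = 1 / 2 + 1 / 2 :> R by lra.
  by rewrite expRD; nra.
have ln_c : 1 <= ln c.
  by rewrite -[leLHS]expRK ler_ln ?posrE ?expR_gt0 //; lra.
have := ln_ge0 ln_c; nra.
Qed.
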